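(* Let $R$ be a ring, let $\mathcal X=\mathcal{SH}(R)\setminus\{0\}$ be the set of all non-zero $sh$-ideals of $R$, and equip $\mathcal X$ with the $SH$-topology. The following statements are equivalent: (1) $\mathcal X$ is a Noetherian topological space. (2) Every subset of $\mathcal X$ is quasi-compact. (3) $R$ satisfies the descending chain condition on semi-$sh$-ideals.
   Context: All rings are associative with $1\neq 0$ (not necessarily commutative); ''ideal'' means two-sided ideal. An ideal $L$ of $R$ is strongly hollow (an $sh$-ideal) if for all ideals $A,B$ of $R$, $L\subseteq A+B$ implies $L\subseteq A$ or $L\subseteq B$. $\mathcal{SH}(R)$ is the set of all $sh$-ideals; it always contains $0$. An ideal $I$ is a semi-$sh$-ideal if it equals the sum of all $sh$-ideals contained in $I$. $SH$-topology: for an ideal $I$ of $R$ put $V(I)=\{L\in\mathcal X: L\subseteq I\}$. The $SH$-topology is the topology on $\mathcal X$ whose closed sets are exactly the sets $V(I)$, $I$ an ideal of $R$ (these satisfy the axioms for closed sets). A topological space is Noetherian if it satisfies the ascending chain condition on open subsets. Quasi-compact means every open cover has a finite subcover (no separation assumed). *)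

(* Defs.v *)
From HB Require Import structures.
From mathcomp Require Import all_boot all_order all_algebra.
From mathcomp Require Import all_classical.
From mathcomp Require Import topology.

Set Implicit Arguments.
Unset Strict Implicit.
Unset Printing Implicit Defensive.

Import GRing.Theory.
Local Open Scope classical_set_scope.
Local Open Scope ring_scope.

Definition acc (T : Type) (F : set_system T) : Prop :=
  forall U : nat -> set T, (forall n, F (U n)) ->
    (forall n, U n `<=` U n.+1) ->
    exists N : nat, forall n, (N <= n)%N -> U n = U N.

Definition dcc (T : Type) (F : set_system T) : Prop :=
  forall U : nat -> set T, (forall n, F (U n)) ->
    (forall n, U n.+1 `<=` U n) ->
    exists N : nat, forall n, (N <= n)%N -> U n = U N.

Definition noetherian_space (T : topologicalType) : Prop := acc (@open T).

Section Ideals.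
Variable R : nzRingType.
Implicit Types A B I L : set R.

(* Two-sided, and not necessarily proper: the whole ring is allowed, unlike
   with the [idealr] predicates of ring_quotient. *)
Definition ideal I : Prop :=
  [/\ I 0,
      forall x y, I x -> I y -> I (x - y),
      forall a x, I x -> I (a * x)
    & forall a x, I x -> I (x * a)].

Definition add_ideal A B : set R := [set a + b | a in A & b in B].

(* The sum of an arbitrary family of ideals: all finite sums of elements of
   members of the family. The empty sum is allowed, so the sum of the empty
   family is the zero ideal. *)
Definition sum_ideals (F : set_system R) : set R :=
  [set x | exists (n : nat) (L : 'I_n -> set R) (u : 'I_n -> R),
    (forall i, F (L i) /\ L i (u i)) /\ x = \sum_(i < n) u i].

Definition sh_ideal L : Prop :=
  ideal L /\ forall A B, ideal A -> ideal B ->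
    L `<=` add_ideal A B -> L `<=` A \/ L `<=` B.

Definition semi_sh_ideal I : Prop :=
  ideal I /\ I = sum_ideals [set L | sh_ideal L /\ L `<=` I].

Lemma ideal0 : ideal [set (0 : R)].
Proof.
split=> //= [x y -> ->|a x ->|a x ->]; first by rewrite subr0.
  by rewrite mulr0.
by rewrite mul0r.
Qed.

Lemma ideal_add A B : ideal A -> ideal B -> ideal (add_ideal A B).
Proof.
move=> [A0 AB Al Ar] [B0 BB Bl Br]; split.
- by exists 0 => //; exists 0 => //; rewrite addr0.
- move=> _ _ [a Aa [b Bb <-]] [a' Aa' [b' Bb' <-]].
  exists (a - a'); first exact: AB.
  by exists (b - b'); [exact: BB | rewrite opprD addrACA].
- move=> r _ [a Aa [b Bb <-]].
  exists (r * a); first exact: Al.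
  by exists (r * b); [exact: Bl | rewrite mulrDr].
- move=> r _ [a Aa [b Bb <-]].
  exists (a * r); first exact: Ar.
  by exists (b * r); [exact: Br | rewrite mulrDl].
Qed.

Lemma ideal_bigcap (J : Type) (F : J -> set R) :
  (forall j, ideal (F j)) -> ideal (\bigcap_j F j).
Proof.
move=> Fi; split=> [j _|x y Fx Fy j _|a x Fx j _|a x Fx j _].
- by have [] := Fi j.
- by have [_ + _ _] := Fi j; apply; [exact: Fx | exact: Fy].
- by have [_ _ + _] := Fi j; apply; exact: Fx.
- by have [_ _ _] := Fi j; apply; exact: Fx.
Qed.

End Ideals.

Definition sh_space (R : nzRingType) : Type :=
  set_type ([set L : set R | sh_ideal L] `\ [set 0]).

HB.instance Definition _ (R : nzRingType) := gen_eqMixin (sh_space R).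
HB.instance Definition _ (R : nzRingType) := gen_choiceMixin (sh_space R).

Section SHTopology.
Variable R : nzRingType.
Implicit Types I : set R.

Definition sh_V I : set (sh_space R) :=
  [set L | (val L : set R) `<=` I].

Definition sh_open : set_system (sh_space R) :=
  [set U | exists2 I, ideal I & U = ~` sh_V I].

Lemma sh_spaceP (L : sh_space R) : sh_ideal (val L) /\ val L <> [set 0].
Proof. by have := set_valP L. Qed.

Lemma sh_openT : sh_open setT.
Proof.
exists [set 0]; first exact: ideal0.
apply/esym; rewrite -subTset => L _ /= L0.
have [[[Lz _ _ _] _] LN0] := sh_spaceP L; apply: LN0.
by apply/seteqP; split=> // _ ->.
Qed.

Lemma sh_openI : setI_closed sh_open.
Proof.
move=> _ _ [A iA ->] [B iB ->].
exists (add_ideal A B); first exact: ideal_add.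
rewrite -setCU; congr (~` _); apply/seteqP; split=> L /=.
  have [A0 _ _ _] := iA; have [B0 _ _ _] := iB.
  case=> sL x /sL Lx; first by exists x => //; exists 0 => //; rewrite addr0.
  by exists 0 => //; exists x => //; rewrite add0r.
by have [[_ shL] _] := sh_spaceP L; exact: shL.
Qed.

Lemma sh_open_bigcup (J : Type) (f : J -> set (sh_space R)) :
  (forall j, sh_open (f j)) -> sh_open (\bigcup_j f j).
Proof.
move=> fo; have /choice[I fI] : forall j, exists I, ideal I /\ f j = ~` sh_V I.
  by move=> j; have [I iI fE] := fo j; exists I.
exists (\bigcap_j I j); first by apply: ideal_bigcap => j; have [] := fI j.
rewrite -[LHS]setCK setC_bigcup; congr (~` _).
apply/seteqP; split=> L /= sL.
  by move=> x Lx j _; have := sL j Logic.I; rewrite (fI j).2 setCK; exact.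
by move=> j _; rewrite (fI j).2 setCK => x /sL; exact.
Qed.

HB.instance Definition _ := isOpenTopological.Build (sh_space R)
  sh_openT sh_openI sh_open_bigcup.

Lemma sh_closedE (C : set (sh_space R)) :
  closed C <-> exists2 I, ideal I & C = sh_V I.
Proof.
rewrite -openC; split=> [[I iI CE]|[I iI ->]]; last by exists I.
by exists I => //; rewrite -[C]setCK CE setCK.
Qed.

End SHTopology.

(* Main.v *)
Require Import Defs.
From mathcomp Require Import all_boot all_order all_algebra.
From mathcomp Require Import finmap.
From mathcomp Require Import all_classical.
From mathcomp Require Import topology.

(* Sending an ideal I to V(I), and a closed set V(J) to the sum of the sh-ideals
   contained in J, gives mutually inverse inclusion-preserving bijections between
   semi-sh-ideals and closed sets, so the chain condition on semi-sh-ideals is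
   the descending chain condition on closed sets. The equivalence of (1) and (2)
   holds in any topological space. *)

Set Implicit Arguments.
Unset Strict Implicit.
Unset Printing Implicit Defensive.

Import GRing.Theory.
Local Open Scope classical_set_scope.
Local Open Scope ring_scope.

Section NoetherianSpace.
Variable T : topologicalType.

(** If no finite subfamily covers [S], adding one useful index at a time makes the finite unions
    grow strictly forever, against the chain condition. *)
Lemma noetherian_cover_compact (S : set T) :
  noetherian_space T -> cover_compact S.
Proof.
move=> noeth I D f fo Sf; apply: contrapT => nofin.
pose in_D (E : {fset I}) := {subset E <= D}.
have /choice[next nextP] : forall E : {fset I}, exists i,
    in_D E -> D i /\ ~ f i `<=` cover [set` E] f.
  move=> E; have [ED|] := pselect (in_D E); last first.
    (* Outside [in_D] any index serves to make [next] total. If [D] is empty, so is [S], and [fset0]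
       already covers it. *)
    move=> nED; have [[i _]|D0] := pselect (exists i, D i); first by exists i.
    have S0 : S `<=` cover [set` fset0] f.
      by move=> x /Sf[i Di _]; case: D0; exists i.
    by case: nofin; exists fset0.
  have /existsNP[x /not_implyP[Sx nEx]] : ~ S `<=` cover [set` E] f.
    by move=> SE; apply: nofin; exists E.
  by have [i Di fix_] := Sf x Sx; exists i => _; split=> // /(_ x fix_).
pose E n := iter n (fun E => next E |` E)%fset fset0.
have ED n : in_D (E n).
  elim: n => [|n IHn] i //=; rewrite in_fset1U => /orP[/eqP ->|]; last exact: IHn.
  by rewrite inE; have [] := nextP _ IHn.
have [|n x [i /= iE fix_]|N EN] := noeth (fun n => cover [set` E n] f).
- by move=> n; apply: bigcup_open => i /ED; rewrite inE; exact: fo.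
- by exists i => //=; rewrite in_fset1U iE orbT.
(* The index added at stage [N] was chosen to enlarge the union, yet the union no longer changes. *)
have [_] := nextP _ (ED N); apply; rewrite -(EN N.+1 (leqnSn N)) => x fx.
by exists (next (E N)) => //=; rewrite in_fset1U eqxx.
Qed.

(** The chain covers its own union, so it stops at the largest index of a finite subcover. *)
Lemma cover_compact_noetherian :
  (forall S : set T, cover_compact S) -> noetherian_space T.
Proof.
move=> compT U Uo Uincr.
have Ule m n : (m <= n)%N -> U m `<=` U n.
  move/subnK <-; elim: (n - m)%N => // k IHk.
  exact: subset_trans IHk (Uincr _).
have [//|E _ UE] := compT (\bigcup_n U n) nat setT U (fun n _ => Uo n).
exists (\max_(i <- E) i)%N => n len; apply/seteqP; split; last exact: Ule.
move=> x Unx; have [|i /= iE Uix] := UE x; first by exists n.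
by apply: Ule Uix; exact: leq_bigmax_seq.
Qed.

End NoetherianSpace.

Section SemiSHIdeals.
Variable R : nzRingType.
Implicit Types (I J L : set R) (F : set_system R).

Lemma ideal_sum_ideals F : F `<=` @ideal R -> ideal (sum_ideals F).
Proof.
move=> Fi; split.
- exists 0%N, (fun=> set0), (fun=> 0).
  by rewrite big_ord0; split=> // -[].
- move=> _ _ [m [L [u [Lu ->]]]] [n [K [v [Kv ->]]]].
  (* The difference is one sum over the concatenated families, with the second family negated. *)
  exists (m + n)%N,
    (fun i : 'I_(m + n) =>
       match fintype.split i with inl j => L j | inr k => K k end),
    (fun i : 'I_(m + n) =>
       match fintype.split i with inl j => u j | inr k => - v k end).
  split=> [i|].
    case: (fintype.split i) => [j|k]; first exact: Lu.
    have [FK Kvk] := Kv k; split=> //; have [K0 KB _ _] := Fi _ FK.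
    by rewrite -sub0r; exact: KB.
  rewrite big_split_ord /= -sumrN; congr (_ + _); apply: eq_bigr => i _.
    by rewrite -[lshift _ _]/(unsplit (inl i)) unsplitK.
  by rewrite -[rshift _ _]/(unsplit (inr i)) unsplitK.
- move=> a _ [n [L [u [Lu ->]]]]; exists n, L, (fun i => a * u i).
  rewrite mulr_sumr; split=> // i; have [FL Lui] := Lu i.
  by split=> //; have [_ _ + _] := Fi _ FL; exact.
- move=> a _ [n [L [u [Lu ->]]]]; exists n, L, (fun i => u i * a).
  rewrite mulr_suml; split=> // i; have [FL Lui] := Lu i.
  by split=> //; have [_ _ _] := Fi _ FL; exact.
Qed.

Lemma sub_sum_ideals F L : F L -> L `<=` sum_ideals F.
Proof.
by move=> FL x Lx; exists 1%N, (fun=> L), (fun=> x); rewrite big_ord1.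
Qed.

Lemma sum_ideals_sub F J :
  ideal J -> (forall L, F L -> L `<=` J) -> sum_ideals F `<=` J.
Proof.
move=> [J0 JB _ _] FJ _ [n [L [u [Lu ->]]]].
have JD x y : J x -> J y -> J (x + y).
  by move=> Jx Jy; rewrite -[y]opprK -[- y]sub0r; apply/JB/JB.
by apply: big_ind => // i _; have [/FJ] := Lu i; apply.
Qed.

Lemma sum_idealsS F G : F `<=` G -> sum_ideals F `<=` sum_ideals G.
Proof.
move=> FG _ [n [L [u [Lu ->]]]]; exists n, L, u; split=> // i.
by have [/FG] := Lu i.
Qed.

Definition sh_below I : set_system R := [set L | sh_ideal L /\ L `<=` I].

(** The sum lies inside [I] and contains each of its summands. Hence every closed set comes from a
    semi-sh-ideal. *)
Lemma sh_below_sum I : ideal I -> sh_below (sum_ideals (sh_below I)) = sh_below I.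
Proof.
move=> iI; apply/seteqP; split=> L [shL LI]; split=> //.
  by apply: (subset_trans LI); apply: sum_ideals_sub => // K [].
exact: sub_sum_ideals.
Qed.

Lemma semi_sh_ideal_sum I : ideal I -> semi_sh_ideal (sum_ideals (sh_below I)).
Proof.
move=> iI; split; first by apply: ideal_sum_ideals => L [[]].
by rewrite -[[set L | _]]/(sh_below _) sh_below_sum.
Qed.

(** The two families differ at most by the zero ideal, which is not a point of the space but lies in
    every ideal [J]. *)
Lemma sh_VS I J : ideal J -> (sh_V I `<=` sh_V J) <-> (sh_below I `<=` sh_below J).
Proof.
move=> iJ; split=> IJ L /=.
  move=> [shL LI]; split=> //.
  have [->|L0] := pselect (L = [set 0]); first by move=> _ ->; case: iJ.
  have LX : L \in [set L : set R | sh_ideal L] `\ [set 0] by rewrite inE.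
  exact: (IJ (SigSub LX)).
by have [shL _] := sh_spaceP L => LI; have [] := IJ (val L) (conj shL LI).
Qed.

Lemma noetherian_dcc : noetherian_space (sh_space R) <-> dcc (@semi_sh_ideal R).
Proof.
split=> [noeth I Iss Idecr|dccR U Uo Uincr].
  have [|n|N VN] := noeth (fun n => ~` sh_V (I n)).
  - by move=> n; exists (I n) => //; have [] := Iss n.
  - by apply: subsetC => L LI; exact: subset_trans LI (Idecr n).
  exists N => n /VN /(congr1 setC); rewrite !setCK => /seteqP[VnN VNn].
  (* A semi-sh-ideal is the sum of its [sh_below], so equal closed sets give equal ideals. *)
  have [[iN ->] [i_n ->]] := (Iss N, Iss n).
  by congr sum_ideals; apply/seteqP; split; apply/sh_VS.
have /choice[J JP] : forall n, exists J, ideal J /\ U n = ~` sh_V J.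
  by move=> n; have [J iJ UE] := Uo n; exists J.
have [iJ UE] : (forall n, ideal (J n)) /\ forall n, U n = ~` sh_V (J n).
  by split=> n; have [] := JP n.
(* The chosen [J n] need not decrease; these sums do, since [sh_below (J n)] is governed by
   [U n]. *)
have [n|n|N IN] := dccR (fun n => sum_ideals (sh_below (J n))).
- exact: semi_sh_ideal_sum.
- by apply/sum_idealsS/sh_VS => //; apply/subsetCP; rewrite -!UE; exact: Uincr.
exists N => n /IN /(congr1 sh_below); rewrite !sh_below_sum // => JnN.
by rewrite !UE; congr (~` _); apply/seteqP; split; apply/sh_VS; rewrite ?JnN.
Qed.

End SemiSHIdeals.

Theorem proposition2p9 (R : nzRingType) :
  (noetherian_space (sh_space R) <->
     forall S : set (sh_space R), cover_compact S) /\
  ((forall S : set (sh_space R), cover_compact S) <->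
     dcc (@semi_sh_ideal R)).
Proof.
have noethE : noetherian_space (sh_space R) <->
    forall S : set (sh_space R), cover_compact S.
  split=> [noeth S|]; first exact: noetherian_cover_compact.
  exact: cover_compact_noetherian.
by split=> //; rewrite -noethE; exact: noetherian_dcc.
Qed.
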